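(* Let $(K,v)$ be a henselian valued field with $v$ non-trivial, and let $a\in K^{\mathrm{sep}}\setminus K$. Assume that $K(a)|K$ is a minimal extension. Then $\# S_K(a) = 1$.
   Context: $\overline{K}$ is a fixed algebraic closure of $K$, $K^{\mathrm{sep}}\subseteq\overline K$ is the separable-algebraic closure of $K$, and the unique extension of $v$ to $\overline{K}$ is again denoted by $v$. For $a\in K^{\mathrm{sep}}\setminus K$, $S_K(a) := \{ v(a-a^\prime) \mid a^\prime\neq a \text{ is a } K\text{-conjugate of } a\}$. A field extension $L|K$ is minimal if it does not admit any proper non-trivial subextension, i.e. there is no field $F$ with $K\subsetneq F\subsetneq L$. *)

(* Defs.v *)
From mathcomp Require Import all_boot all_order all_algebra all_field.
From mathcomp Require Import mathcomp_extra boolp classical_sets functions.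
From mathcomp Require Import cardinality.

Set Implicit Arguments.
Unset Strict Implicit.
Unset Printing Implicit Defensive.

Import Order.TTheory GRing.Theory Num.Theory.

Local Open Scope classical_set_scope.
Local Open Scope ring_scope.

(* Totally ordered abelian groups: [porderZmodType] imposes neither totality
   nor any compatibility between the order and the addition. *)
Record orderedAbGroupType := OrderedAbGroup {
  ordered_group_sort :> porderZmodType;
  ordered_group_total : total (<=%R : rel ordered_group_sort);
  ordered_group_leD2l : forall z x y : ordered_group_sort,
    x <= y -> z + x <= z + y
}.

Section Infinity.
Variable G : orderedAbGroupType.

(* [option G] stands for G extended with a largest, absorbing element oo,
   represented by [None]. *)
Definition oadd (g h : option G) : option G :=
  if g is Some x then if h is Some y then Some (x + y) else None else None.

Definition ole (g h : option G) : bool :=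
  if h is Some y then if g is Some x then x <= y else false else true.

Definition omin (g h : option G) : option G := if ole g h then g else h.

End Infinity.

(* Krull valuations, of arbitrary rank. The map K^* -> G need not be
   surjective: G is any ordered abelian group containing the value group. *)
Record valuation (K : fieldType) (G : orderedAbGroupType) := Valuation {
  val_fun :> K -> option G;
  val_eq_oo : forall x, val_fun x = None <-> x = 0;
  val_mul : forall x y, val_fun (x * y) = oadd (val_fun x) (val_fun y);
  val_add : forall x y, ole (omin (val_fun x) (val_fun y)) (val_fun (x + y))
}.

Definition nontrivial_val (K : fieldType) (G : orderedAbGroupType)
    (v : valuation K G) : Prop :=
  exists x, x != 0 /\ v x <> Some 0.

(* w restricts to v along iota : K -> L, once G is identified with a subgroup
   of H by means of some order embedding e. *)
Definition extends_val (K L : fieldType) (iota : {rmorphism K -> L})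
    (G H : orderedAbGroupType) (v : valuation K G) (w : valuation L H) : Prop :=
  exists2 e : {additive G -> H},
    (forall x y, (e x <= e y) = (x <= y)) &
    (forall x, w (iota x) = omap e (v x)).

Definition equiv_val (L : fieldType) (G H : orderedAbGroupType)
    (v : valuation L G) (w : valuation L H) : Prop :=
  forall x, ole (Some 0) (v x) = ole (Some 0) (w x).

(* (K, v) is henselian when v extends uniquely, up to equivalence, to every
   algebraic extension of K; an extension always exists (Chevalley), so only
   uniqueness is a condition. *)
Definition henselian (K : fieldType) (G : orderedAbGroupType)
    (v : valuation K G) : Prop :=
  forall (L : fieldType) (iota : {rmorphism K -> L}), integralRange iota ->
  forall (H1 H2 : orderedAbGroupType)
    (w1 : valuation L H1) (w2 : valuation L H2),
    extends_val iota v w1 -> extends_val iota v w2 -> equiv_val w1 w2.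

Section Extensions.
Variables (K L : fieldType) (iota : {rmorphism K -> L}).

Definition is_minpoly (a : L) (p : {poly K}) : Prop :=
  [/\ p \is monic, irreducible_poly p & root (map_poly iota p) a].

Definition separable_over (a : L) : Prop :=
  exists2 p, is_minpoly a p & separable_poly p.

Definition conjugate_over (a b : L) : Prop :=
  exists2 p, is_minpoly a p & is_minpoly b p.

(* The intermediate fields of L | K. *)
Definition subextension (F : set L) : Prop :=
  GRing.divring_closed (mem F) /\ range iota `<=` F.

Definition adjoin (a : L) : set L := smallest subextension [set a].

Definition minimal_extension (E : set L) : Prop :=
  ~ exists F, [/\ subextension F, range iota `<` F & F `<` E].

Definition conj_dist_set (G : orderedAbGroupType) (w : valuation L G) (a : L) :
    set (option G) :=
  [set w (a - b) | b in [set b | conjugate_over a b /\ b != a]].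

End Extensions.

(* Main.v *)
From HB Require Import structures.
Require Import Defs.
From mathcomp Require Import all_boot all_order all_algebra all_field.
From mathcomp Require Import fingroup.
From mathcomp Require Import mathcomp_extra boolp classical_sets functions.
From mathcomp Require Import cardinality.

Set Implicit Arguments.
Unset Strict Implicit.
Unset Printing Implicit Defensive.

Local Open Scope classical_set_scope.
Local Open Scope card_scope.
Local Open Scope ring_scope.

Import Order.TTheory GRing.Theory.

(* Let N be a splitting field of the minimal polynomial of a. As v is henselian,
   Gal(N|K) preserves the valuation of N, so for every gamma the automorphisms s
   with v(a - s(a)) >= gamma form a group, which contains Gal(N|K(a)); its fixed
   field lies between K and K(a), hence is one of them. If S_K(a) had two
   elements, taking the larger one for gamma gives a group containing some s
   which moves a, and omitting some other s: its fixed field is neither K(a)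
   nor K. *)

(** * The order on a value group with oo adjoined *)

Section OrderedAbGroup.
Variable G : orderedAbGroupType.
Implicit Types (x y z : G) (g h k : option G).

Lemma ordered_group_lerD x y z t : x <= y -> z <= t -> x + z <= y + t.
Proof.
move=> le_xy le_zt; apply: (le_trans (ordered_group_leD2l x le_zt)).
by rewrite ![_ + t]addrC ordered_group_leD2l.
Qed.

Lemma ole_refl g : ole g g.
Proof. by case: g => /=. Qed.

Lemma ole_trans g h k : ole g h -> ole h k -> ole g k.
Proof. by case: g h k => [x|] [y|] [z|] //=; apply: le_trans. Qed.

Lemma ole_anti g h : ole g h -> ole h g -> g = h.
Proof.
by case: g h => [x|] [y|] //= xy yx; congr Some; apply/eqP; rewrite eq_le xy.
Qed.

Lemma ole_total g h : ole g h || ole h g.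
Proof. by case: g h => [x|] [y|] //=; apply: ordered_group_total. Qed.

Lemma ole_omin g h k : ole g (omin h k) = ole g h && ole g k.
Proof.
rewrite /omin; case: ifP => [hk|/negbT hk].
  by case gh: (ole g h) => //=; rewrite (ole_trans gh hk).
have kh : ole k h by move: (ole_total h k); rewrite (negbTE hk).
by case gk: (ole g k); rewrite ?andbF ?andbT // (ole_trans gk kh).
Qed.

End OrderedAbGroup.

(** * Signs of values, and infinitude of a nontrivially valued field *)

Section ValuationTheory.
Variables (K : fieldType) (G : orderedAbGroupType) (v : valuation K G).

Lemma val0 : v 0 = None.
Proof. by apply/val_eq_oo. Qed.

Lemma val1 : v 1 = Some 0.
Proof.
have := val_mul v 1 1; rewrite mulr1; case v1: (v 1) => [g|] /=.
  by case=> /esym/eqP; rewrite -subr_eq0 addrK => /eqP->.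
by move/val_eq_oo/eqP: v1; rewrite oner_eq0.
Qed.

Lemma ole_valD g x y : ole g (v x) -> ole g (v y) -> ole g (v (x + y)).
Proof.
by move=> gx gy; apply: ole_trans (val_add v x y); rewrite ole_omin gx.
Qed.

Lemma val_ge0_prod (I : finType) (P : pred I) (F : I -> K) :
  (forall i, P i -> ole (Some 0) (v (F i))) ->
  ole (Some 0) (v (\prod_(i | P i) F i)).
Proof.
move=> Fge0; elim/big_ind: _ => // [|x y]; first by rewrite val1 ole_refl.
rewrite val_mul; case: (v x) (v y) => [g|] [h|] //= g0 h0.
by rewrite -[0]addr0 ordered_group_lerD.
Qed.

Lemma val_unit_eq0 y : y != 0 ->
  ole (Some 0) (v y) -> ole (Some 0) (v y^-1) -> v y = Some 0.
Proof.
move=> y0; have := val_mul v y y^-1; rewrite divff // val1.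
case: (v y) (v y^-1) => [g|] [h|] //= [gh0] g0 h0; apply: ole_anti => //=.
by rewrite gh0 -[leLHS]addr0 ordered_group_leD2l.
Qed.

Lemma val_inv_ge0 y : y != 0 ->
  ole (Some 0) (v y) || ole (Some 0) (v y^-1).
Proof.
move=> y0; have := val_mul v y y^-1; rewrite divff // val1.
case: (v y) (v y^-1) => [g|] [h|] //= [gh0].
case/orP: (ordered_group_total 0 g) => [->//|g0]; apply/orP; right.
by rewrite gh0 -[leRHS]add0r ordered_group_lerD.
Qed.

(** Up to inverting c, its value is nonnegative; if c^n = 1, then c^-1 = c^(n-1) also has
    nonnegative value, which forces v(c) = 0. *)
Lemma valX_neq1 c n : c != 0 -> v c <> Some 0 -> (0 < n)%N -> c ^+ n <> 1.
Proof.
move=> c0 vc n0 cn1; apply: vc.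
wlog vc_ge0 : c c0 cn1 / ole (Some 0) (v c).
  move=> IH; case/orP: (val_inv_ge0 c0) => [/IH|vcV]; first exact.
  have: v c^-1 = Some 0 by apply: IH; rewrite ?invr_eq0 // exprVn cn1 invr1.
  move=> vcV0; have := val_mul v c c^-1; rewrite divff // val1 vcV0.
  by case: (v c) => //= g; rewrite addr0.
apply: val_unit_eq0 => //; case: n => // n in n0 cn1 *.
rewrite (_ : c^-1 = c ^+ n); last by apply: (mulfI c0); rewrite -exprS cn1 divff.
by rewrite -[n]card_ord -prodr_const; apply: val_ge0_prod.
Qed.

(** The powers of an element of nonzero value are distinct. This supplies the scalars for the
    primitive element argument. *)
Lemma nontrivial_val_infinite (n : nat) : nontrivial_val v ->
  exists2 s : seq K, uniq s & size s = n.
Proof.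
move=> [c [c0 vc]]; exists (mkseq (fun i => c ^+ i) n); last by rewrite size_mkseq.
apply: mkseq_uniq => i j; wlog ij : i j / (i <= j)%N => [IH cij|cij].
  by case/orP: (leq_total i j) => /IH h; [apply: h | apply/esym/h].
apply/eqP; rewrite eqn_leq ij leqNgt; apply/negP => ji.
apply: (@valX_neq1 c (j - i) c0 vc); first by rewrite subn_gt0.
have ci0 : c ^+ i != 0 by rewrite expf_neq0.
by apply: (mulfI ci0); rewrite mulr1 -exprD subnKC.
Qed.

End ValuationTheory.

(** * Pullback of a valuation along a field morphism *)

Section ValuationComp.
Variables (K L : fieldType) (G : orderedAbGroupType) (v : valuation L G).
Variable f : {rmorphism K -> L}.

Fact val_comp_eq_oo x : v (f x) = None <-> x = 0.
Proof.
split=> [/val_eq_oo/eqP|->]; last by rewrite rmorph0 val0.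
by rewrite fmorph_eq0 => /eqP.
Qed.

Fact val_compM x y : v (f (x * y)) = oadd (v (f x)) (v (f y)).
Proof. by rewrite rmorphM val_mul. Qed.

Fact val_compD x y : ole (omin (v (f x)) (v (f y))) (v (f (x + y))).
Proof. by rewrite rmorphD val_add. Qed.

Definition val_comp : valuation K G :=
  Valuation val_comp_eq_oo val_compM val_compD.

End ValuationComp.

(** * Minimal polynomials and primitive elements *)

Section Conjugates.
Variables (K L : fieldType) (iota : {rmorphism K -> L}).

(** The gcd is taken over K: were it constant, p and q would stay coprime over L and could not share
    the root a. *)
Lemma irreducible_root_dvdp (p q : {poly K}) a : irreducible_poly p ->
  root (map_poly iota p) a -> root (map_poly iota q) a -> p %| q.
Proof.
move=> [p1 irr_p] pa qa.
suff /eqp_dvdl <- : gcdp p q %= p by apply: dvdp_gcdr.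
apply: irr_p (dvdp_gcdl _ _); apply/negP => gcd1.
have: coprimep (map_poly iota p) (map_poly iota q).
  by rewrite coprimep_map /coprimep gcd1.
by move/coprimep_root => /(_ _ pa); rewrite -rootE qa.
Qed.

Lemma is_minpoly_uniq a p q :
  is_minpoly iota a p -> is_minpoly iota a q -> p = q.
Proof.
move=> [mp ip pa] [mq iq qa]; apply/eqP; rewrite -eqp_monic //.
by rewrite /eqp (irreducible_root_dvdp ip pa qa) (irreducible_root_dvdp iq qa pa).
Qed.

(* The last clause says that z is a K-linear combination of the elements of s:
   it is what makes K(z) no larger than K(s). *)
Lemma primitive_element (s : seq L) :
  (forall n, exists2 r : seq K, uniq r & size r = n) ->
  integralRange iota ->
  (forall x, x \in s -> exists2 q, root (map_poly iota q) x & separable_poly q) ->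
  exists z,
    (forall x, x \in s -> exists q, (map_poly iota q).[z] = x) /\
    (forall P : L -> Prop, P 0 ->
       (forall t x y, P x -> P y -> P (iota t * y - x)) ->
       (forall x, x \in s -> P x) -> P z).
Proof.
move=> infK intL; elim: s => [|y s IHs] sep_s; first by exists 0.
have [x xs|x [sz gz]] := IHs; first by apply: sep_s; rewrite inE xs orbT.
have [q qy sep_q] := sep_s y (mem_head _ _).
have /integral_algebraic[p nz_p px] := intL x.
(* Every t in K with [iota t] not a root of r makes [iota t * y - x] a generator of K(x, y). A
   nonzero r has fewer than [size r] roots, so among [size r] distinct scalars one is suitable. *)
have [r nz_r PETr] := large_field_PET nz_p px qy sep_q.
have [ts uts sz_ts] := infK (size r).
have /allPn[t _ nz_rt] : ~~ all (fun t => root r (iota t)) ts.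
  rewrite -(all_map iota (root r)); apply/negP => all_r; have := ltnn (size r).
  rewrite -{1}sz_ts -(size_map iota) => /negP; case; apply: max_poly_roots => //.
  by rewrite map_inj_uniq //; apply: fmorph_inj.
have /= [[p1 Dx] [q1 Dy]] := PETr t nz_rt.
exists (iota t * y - x); split=> [w|P P0 PD Ps].
  rewrite inE => /predU1P[->|/sz[q2 Dw]]; first by exists q1.
  by exists (q2 \Po p1); rewrite map_comp_poly horner_comp Dx.
apply: (PD); last by apply: (Ps); apply: mem_head.
by apply: gz => // w ws; apply: Ps; rewrite inE ws orbT.
Qed.

End Conjugates.

(** * A finite Galois extension of K embedded in the algebraic closure *)

Section SplittingFieldIn.
Variables (K : fieldType) (Kbar : closedFieldType).
Variable iota : {rmorphism K -> Kbar}.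

(** K(z) is rebuilt as K[X]/(q), with q the minimal polynomial of z, so that finite-dimensional
    Galois theory applies to it. *)
Lemma simple_extension_in z : integralOver iota z ->
  exists (E : fieldExtType K) (j : {rmorphism E -> Kbar}) (z0 : E),
    [/\ forall c, j c%:A = iota c, j z0 = z & <<1; z0>>%VS = {:E}%VS].
Proof.
move=> intz.
have [q [_ qz irr_q]] := minPoly_decidable_closure (fun y => pselect _) intz.
have nz_q := irredp_neq0 irr_q.
exists (SubFieldExtType qz irr_q), (@subfx_inj _ _ iota z q).
exists (subfx_root iota z q); split.
- by move=> c; apply: subfx_inj_base.
- exact: subfx_inj_root.
apply/vspaceP => u; rewrite memvf; apply/Fadjoin1_polyP.
by have [f] := subfxEroot qz nz_q u; exists f.
Qed.

Lemma horner_embedding (E : fieldExtType K) (j : {rmorphism E -> Kbar})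
    (f : {poly K}) u : (forall c, j c%:A = iota c) ->
  j (map_poly (in_alg E) f).[u] = (map_poly iota f).[j u].
Proof.
move=> jA; rewrite -horner_map -map_poly_comp; congr _.[_].
by apply: eq_map_poly => c; apply: jA.
Qed.

Lemma splitting_field_in (p : {poly K}) :
  (forall n, exists2 r : seq K, uniq r & size r = n) ->
  integralRange iota -> separable_poly p ->
  exists (N : splittingFieldType K) (j : {rmorphism N -> Kbar}),
    [/\ forall c, j c%:A = iota c,
        galois 1 {:N}
      & forall b, root (map_poly iota p) b -> exists u, j u = b].
Proof.
move=> infK intK sep_p; have nz_p := separable_poly_neq0 sep_p.
have [rs Dp] := closed_field_poly_normal (map_poly iota p).
have nz_lc : lead_coef (map_poly iota p) != 0.
  by rewrite lead_coef_eq0 map_poly_eq0.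
have root_rs b : root (map_poly iota p) b = (b \in rs).
  by rewrite Dp rootZ // root_prod_XsubC.
have [|z [zrs genz]] := primitive_element (s := rs) infK intK.
  by move=> x xrs; exists p; rewrite ?root_rs.
have [E [j [z0 [jA jz defE]]]] := simple_extension_in (intK z).
(* Each root is a polynomial in z; evaluating that polynomial at [z0] lifts the root to E. *)
have [rs' Drs] : exists rs' : seq E, map j rs' = rs.
  have: {subset rs <= rs} by [].
  elim: {1 3}rs => [|x r IHr] sub; first by exists [::].
  have [|r' <-] := IHr; first by move=> y yr; apply: sub; rewrite inE yr orbT.
  have [f Dx] := zrs x (sub _ (mem_head _ _)).
  exists ((map_poly (in_alg E) f).[z0] :: r').
  by rewrite /= (horner_embedding _ _ jA) jz Dx.
have p_over1 : map_poly (in_alg E) p \is a polyOver 1%VS.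
  by apply/polyOver1P; exists p.
have splitp : splittingFieldFor 1 (map_poly (in_alg E) p) {:E}.
  exists rs'.
    rewrite -(eqp_map j) -map_poly_comp (eq_map_poly jA) Dp.
    rewrite (eqp_ltrans (eqp_scale _ nz_lc)) rmorph_prod -Drs big_map /=.
    by rewrite (eq_bigr _ (fun u _ => map_polyXsubC j u)) eqpxx.
  (* The image of K([rs']) contains the roots and is stable under K-linear combinations, so it
     contains z. Hence [z0] lies in K([rs']), which is therefore all of E. *)
  have [u rsu ju] : exists2 u, u \in <<1 & rs'>>%VS & j u = z.
    apply: (genz (fun y => exists2 u, u \in <<1 & rs'>>%VS & j u = y))
      => [|t x y [u Uu <-] [w Uw <-]|x].
    - by exists 0; rewrite ?rmorph0 ?mem0v.
    - exists (t *: w - u); first by rewrite rpredB // memvZ.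
      by rewrite rmorphB -mulr_algl rmorphM jA.
    - rewrite -Drs => /mapP[u us ->]; exists u => //.
      by apply: seqv_sub_adjoin.
  have {}ju : u = z0 by apply: (fmorph_inj j); rewrite ju jz.
  apply/eqP; rewrite eqEsubv subvf -defE; apply/FadjoinP.
  by rewrite -ju rsu sub1v.
have splitE : splitting_field_axiom E by exists (map_poly (in_alg E) p).
pose N : splittingFieldType K :=
  HB.pack (GRing.Algebra.sort E) (FieldExt_isSplittingField.Build K E splitE).
exists N, j; split => // [|b].
  apply/splitting_galoisField; exists (map_poly (in_alg E) p).
  by split; rewrite ?separable_map.
by rewrite root_rs -Drs => /mapP[u _ ->]; exists u.
Qed.

End SplittingFieldIn.

(** * Galois invariance of the valuation *)

Section HenselianConjugation.
Variables (K : fieldType) (N : splittingFieldType K).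
Variables (G H : orderedAbGroupType) (v : valuation K G) (w : valuation N H).
Hypotheses (hv : henselian v) (hvw : extends_val (in_alg N) v w).

(** Both w and its composite with s extend v. Uniqueness holds only up to equivalence, so at first
    it compares valuation rings rather than values. *)
Lemma gal_val_ge0 (s : gal_of {:N}) x :
  ole (Some 0) (w (s x)) = ole (Some 0) (w x).
Proof.
have hvs : extends_val (in_alg N) v (val_comp w s).
  case: hvw => e e_mono ve; exists e => // c.
  by rewrite -ve /= linearZ rmorph1.
exact/esym/(hv (@alg_integral K N) hvw hvs x).
Qed.

(* If w(y) >= 0 and y has norm 1, then y^-1 is the product of the other
   conjugates of y, so that w(y) = 0; apply this to y = s(x)/x. *)
Lemma gal_val (s : gal_of {:N}) x : w (s x) = w x.
Proof.
have [->|x0] := eqVneq x 0; first by rewrite rmorph0.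
have unit_norm1 y : galNorm 1 {:N} y = 1 -> ole (Some 0) (w y) ->
    ole (Some 0) (w y^-1).
  move=> Ny y_ge0; have y0 : y != 0.
    by apply: contra_eq_neq Ny => ->; rewrite galNorm0 eq_sym oner_eq0.
  have -> : y^-1 = \prod_(t in 'Gal({:N} / 1)%g | t != 1%g) t y.
    apply: (mulfI y0); rewrite divff //; transitivity (galNorm 1 {:N} y) => //.
    by rewrite /galNorm (bigD1 (1%g : gal_of {:N})) ?group1 //= gal_id.
  by apply: val_ge0_prod => t _; rewrite gal_val_ge0.
have s_gal : s \in 'Gal({:N} / 1)%g.
  rewrite gal_kHom ?sub1v // k1HomE.
  exact: (valP (gal_repr s)).
have sx0 : s x != 0 by rewrite fmorph_eq0.
pose y := s x / x; have y0 : y != 0 by rewrite mulf_neq0 ?invr_eq0.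
have Ny : galNorm 1 {:N} y = 1.
  by rewrite galNormM galNormV galNorm_gal ?memvf // divff // galNorm_eq0.
have NyV : galNorm 1 {:N} y^-1 = 1 by rewrite galNormV Ny invr1.
have wy : w y = Some 0.
  (* One of y and y^-1 has nonnegative value; both have norm 1, so the other one does too. *)
  apply: val_unit_eq0 => //; case/orP: (val_inv_ge0 w y0) => //.
    by move/unit_norm1: NyV => /[apply]; rewrite invrK.
  exact: unit_norm1.
have -> : s x = y * x by rewrite divfK.
rewrite val_mul wy.
by case: (w x) => //= g; rewrite add0r.
Qed.

(** Stability under products comes from x - t(s(x)) = (x - t(x)) + t(x - s(x)) and the invariance of
    w under t; in a finite group this suffices for a subgroup. *)
Lemma group_set_gal_close g (x : N) :
  group_set [set s : gal_of {:N} | ole g (w (x - s x))].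
Proof.
apply/group_setP; split=> [|s t]; rewrite ?inE ?gal_id ?subrr ?val0 ?galM ?memvf //.
move=> gs gt; rewrite -(subrKA (t x)) -rmorphB.
by apply: ole_valD => //; rewrite gal_val.
Qed.

End HenselianConjugation.

(** * Transfer of intermediate fields from N to the algebraic closure *)

Section Intermediate.
Variables (K : fieldType) (Kbar : fieldType) (iota : {rmorphism K -> Kbar}).
Variables (N : fieldExtType K) (j : {rmorphism N -> Kbar}).
Hypothesis jA : forall c, j c%:A = iota c.

Lemma subextension_image (F : {subfield N}) :
  subextension iota [set j u | u in [set u | u \in F]].
Proof.
split; last by move=> _ [c _ <-]; exists c%:A => //=; rewrite memvZ ?mem1v.
split=> [|x y|x y].
- by apply/mem_set; exists 1; rewrite /= ?mem1v ?rmorph1.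
- move=> /set_mem[u /= Fu <-] /set_mem[t /= Ft <-]; apply/mem_set.
  by exists (u - t); rewrite /= ?rpredB ?rmorphB.
- move=> /set_mem[u /= Fu <-] /set_mem[t /= Ft <-]; apply/mem_set.
  by exists (u / t); rewrite /= ?fmorph_div // rpred_div.
Qed.

(** Elements of K(u) are polynomials in u, and Horner induction puts their images in any
    subextension S containing [j u]. Sums and products in S are first derived from differences and
    quotients. *)
Lemma image_sub_adjoin (F : {vspace N}) u : (F <= <<1; u>>)%VS ->
  [set j t | t in [set t | t \in F]] `<=` adjoin iota (j u).
Proof.
move=> sF _ [t /= Ft <-] S [[divS sKS] Su].
have /Fadjoin1_polyP[f ->] := subvP sF t Ft.
have Sju : mem S (j u) by apply/mem_set/Su.
have SB x y : mem S x -> mem S y -> mem S (x - y) by case: divS => _ + _; apply.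
have S1 : mem S 1 by case: divS.
have SV x y : mem S x -> mem S y -> mem S (x / y) by case: divS => _ _; apply.
have S0 : mem S 0 by rewrite -(subrr 1); apply: SB.
have SD x y : mem S x -> mem S y -> mem S (x + y).
  by move=> Sx Sy; rewrite -[y]opprK; apply: (SB) => //; rewrite -sub0r; apply: SB.
have SM x y : mem S x -> mem S y -> mem S (x * y).
  by move=> Sx Sy; rewrite -[y]invrK -[y^-1]div1r; apply: (SV) => //; apply: SV.
apply/set_mem; elim/poly_ind: f => [|f c IHf].
  by rewrite rmorph0 horner0 rmorph0.
rewrite rmorphD rmorphM /= map_polyX map_polyC hornerMXaddC rmorphD rmorphM /= jA.
by apply: SD; [apply: SM | apply/mem_set/sKS; exists c].
Qed.

End Intermediate.

(** If a were the only root of its separable minimal polynomial p, then p would be X - a and a would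
    come from the constant coefficient of p. *)
Lemma exists_conjugate (K : fieldType) (L : closedFieldType)
    (iota : {rmorphism K -> L}) (a : L) :
  separable_over iota a -> ~ range iota a ->
  exists2 b, conjugate_over iota a b & b != a.
Proof.
move=> [p [mp irr_p pa] sep_p] aK.
have [rs] := closed_field_poly_normal (map_poly iota p).
rewrite lead_coef_map (monicP mp) rmorph1 scale1r => Dp.
have urs : uniq rs by rewrite -separable_prod_XsubC -Dp separable_map.
have [/hasP[b brs ba]|] := boolP (has (predC1 a) rs).
  by exists b => //; exists p; split; rewrite // Dp root_prod_XsubC.
rewrite has_predC negbK => /all_pred1P rsE; case: aK.
have ars : a \in rs by rewrite -root_prod_XsubC -Dp.
have Drs : rs = [:: a].
  by move: urs ars; rewrite rsE; case: (size rs) => [|[|n]] //=; rewrite inE eqxx.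
exists (- p`_0) => //; rewrite rmorphN -coef_map Dp Drs big_seq1.
by rewrite coefB coefX coefC eqxx sub0r opprK.
Qed.

Theorem theorem1p2
  (K : fieldType) (G : orderedAbGroupType) (v : valuation K G)
  (hv : henselian v) (hnt : nontrivial_val v)
  (Kbar : closedFieldType) (iota : {rmorphism K -> Kbar})
  (halg : integralRange iota)
  (H : orderedAbGroupType) (vbar : valuation Kbar H)
  (hext : extends_val iota v vbar)
  (a : Kbar) (hsep : separable_over iota a) (haK : ~ range iota a)
  (hmin : minimal_extension iota (adjoin iota a)) :
  conj_dist_set iota vbar a #= `I_1.
Proof.
have [b0 conj_b0 b0a] := exists_conjugate hsep haK.
suff S1 : conj_dist_set iota vbar a = [set vbar (a - b0)].
  by rewrite S1; apply: card_set1.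
(* One inequality is enough, since b and c can be exchanged. *)
suff le_dist b c : conjugate_over iota a b -> b != a ->
    conjugate_over iota a c -> c != a -> ole (vbar (a - c)) (vbar (a - b)).
  apply/seteqP; split=> [_ [b [conj_b ba] <-]|_ ->]; last by exists b0.
  by apply: ole_anti; apply: le_dist.
move=> conj_b ba conj_c ca; apply/negPn/negP => lt_bc.
have [p [mp irr_p pa] sep_p] := hsep.
have root_conj d : conjugate_over iota a d -> root (map_poly iota p) d.
  by case=> q qa [_ _ qd]; rewrite (is_minpoly_uniq (And3 mp irr_p pa) qa).
have infK n := nontrivial_val_infinite n hnt.
have [N [j [jA galN rootN]]] := splitting_field_in infK halg sep_p.
have [al Da] := rootN a pa.
have hvw : extends_val (in_alg N) v (val_comp vbar j).
  by case: hext => e e_mono ve; exists e => // x; rewrite -ve -jA.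
(* p divides the minimal polynomial of [al] over K, so the lift of d is a root of the latter, and
   normality of N gives an automorphism taking [al] to it. *)
have gal_conj d : conjugate_over iota a d ->
    exists s : gal_of {:N}, j (s al) = d.
  move=> conj_d; have [u Du] := rootN d (root_conj d conj_d).
  have /and3P[_ _ nN] := galN.
  have [|s _ su] := @normalField_root_minPoly _ _ _ _ al u (sub1v _) nN (memvf _).
    have /polyOver1P[q Dq] := minPolyOver 1 al.
    have /dvdpP[r Dr] : p %| q.
      apply: irreducible_root_dvdp irr_p pa _.
      by rewrite -Da rootE -(horner_embedding _ _ jA) -Dq minPolyxx rmorph0.
    rewrite Dq Dr rmorphM rootM; apply/orP; right.
    rewrite rootE -(fmorph_eq0 j) (horner_embedding _ _ jA) Du.
    exact: root_conj.
  by exists s; rewrite su.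
have [s Ds] := gal_conj b conj_b; have [t Dt] := gal_conj c conj_c.
(* The threshold is the larger distance v(a - c): t attains it, while s, which takes a to b, falls
   short. *)
pose A := Group (group_set_gal_close hv hvw (vbar (a - c)) al).
have At : t \in A by rewrite inE /= rmorphB Da Dt ole_refl.
have As : s \notin A by rewrite inE /= rmorphB Da Ds.
pose F := fixedField_aspace A.
apply: hmin; exists [set j u | u in [set u | u \in F]]; split.
- exact: subextension_image.
- split; first by case: (subextension_image jA F).
  (* If F were K, the Galois correspondence would make A the whole group, against the choice of
     s. *)
  move=> sF1; have F1 : F = 1%AS :> {vspace N}.
    apply/eqP; rewrite eqEsubv sub1v andbT; apply/subvP => u Fu.
    have [x _ Dx] := sF1 (j u) (ex_intro2 _ _ u Fu erefl).
    by move: Dx; rewrite -jA => /fmorph_inj <-; rewrite memvZ ?mem1v.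
  case/negP: As; rewrite -(gal_fixedField A) -/F F1.
  by rewrite gal_kHom ?sub1v // k1HomE; apply: (valP (gal_repr s)).
- split; last first.
    (* If a came from F, then t, being in A, would fix [al], giving c = a. *)
    move=> /(_ a)[|u /= Fu]; first by apply: sub_gen_smallest.
    rewrite -Da => /fmorph_inj Du; case/eqP: ca; rewrite -Dt -Da -Du.
    by have [_ ->] := mem_fixedFieldP Fu.
  rewrite -Da; apply: image_sub_adjoin => //.
  (* K([al]) is the fixed field of its Galois group. That group lies in A, because its elements fix
     [al] and so give distance oo; taking fixed fields reverses the inclusion. *)
  have galal : galois <<1; al>> {:N}.
    by apply: galoisS galN; rewrite sub1v subvf.
  rewrite -(elimT galois_fixedField galal); apply: fixedFieldS.
  apply/fintype.subsetP => r r_al; rewrite inE (fixed_gal (subvf _) r_al).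
    by rewrite subrr val0.
  exact: memv_adjoin.
Qed.
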